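(* Let $p$ be a prime and $q$ a power of $p$. For every integer $n\ge 4$, the group $\mathrm{SL}(n,\overline{\mathbb{F}_q})$ is not acceptable.
   Context: $\overline{\mathbb{F}_q}$ denotes an algebraic closure of the finite field $\mathbb{F}_q$, and $\mathrm{SL}(n,\overline{\mathbb{F}_q})$ is the group of $n\times n$ matrices of determinant $1$ over it. Let $\Gamma$ be a group and $H$ a finite group. Two homomorphisms $\phi_1,\phi_2:H\to\Gamma$ are element-conjugate if for every $x\in H$ there is $h(x)\in\Gamma$ with $\phi_1(x)=h(x)^{-1}\phi_2(x)h(x)$; they are globally conjugate if one can choose a single $h\in\Gamma$ with $\phi_1(x)=h^{-1}\phi_2(x)h$ for all $x\in H$. The group $\Gamma$ is acceptable if for every finite group $H$, any two element-conjugate homomorphisms $H\to\Gamma$ are globally conjugate. *)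

(* Defs.v *)
From HB Require Import structures.
From mathcomp Require Import all_boot all_order all_fingroup all_algebra.

Set Implicit Arguments.
Unset Strict Implicit.
Unset Printing Implicit Defensive.

Import GRing.Theory.

(* MathComp has a general linear group only over finite rings, so the possibly
   infinite SL(n, R) is set up here as a groupType. *)
Record SL (n : nat) (R : comUnitRingType) := SpecialLinear {
  SLval : 'M[R]_n;
  SLdet : (\det SLval == 1)%R
}.

HB.instance Definition _ (n : nat) (R : comUnitRingType) :=
  [isSub for @SLval n R].
HB.instance Definition _ (n : nat) (R : comUnitRingType) :=
  [Choice of SL n R by <:].

Section SpecialLinearGroup.
Variables (n : nat) (R : comUnitRingType).
Implicit Types A B : SL n R.
Local Open Scope ring_scope.

Fact SL_one_subproof : \det (1%:M : 'M[R]_n) == 1.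
Proof. by rewrite det1. Qed.

Fact SL_mul_subproof A B : \det (SLval A *m SLval B) == 1.
Proof. by rewrite det_mulmx !(eqP (SLdet _)) mulr1. Qed.

Fact SL_inv_subproof A : \det (invmx (SLval A)) == 1.
Proof. by rewrite det_inv (eqP (SLdet A)) invr1. Qed.

Definition SL_one : SL n R := SpecialLinear SL_one_subproof.
Definition SL_mul A B : SL n R := SpecialLinear (SL_mul_subproof A B).
Definition SL_inv A : SL n R := SpecialLinear (SL_inv_subproof A).

Lemma SLval_unitmx A : SLval A \in unitmx.
Proof. by rewrite unitmxE (eqP (SLdet A)) unitr1. Qed.

Fact SL_mulA : associative SL_mul.
Proof. by move=> A B C; apply: val_inj; apply: mulmxA. Qed.

Fact SL_mul1 : left_id SL_one SL_mul.
Proof. by move=> A; apply: val_inj; apply: mul1mx. Qed.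

Fact SL_mulr1 : right_id SL_one SL_mul.
Proof. by move=> A; apply: val_inj; apply: mulmx1. Qed.

Fact SL_mulV : left_inverse SL_one SL_inv SL_mul.
Proof. by move=> A; apply: val_inj; apply: mulVmx; apply: SLval_unitmx. Qed.

Fact SL_mulrV : right_inverse SL_one SL_inv SL_mul.
Proof. by move=> A; apply: val_inj; apply: mulmxV; apply: SLval_unitmx. Qed.

HB.instance Definition _ := isGroup.Build (SL n R)
  SL_mulA SL_mul1 SL_mulr1 SL_mulV SL_mulrV.

End SpecialLinearGroup.

Section Acceptable.
Local Open Scope group_scope.

(* In MathComp, a ^ h is the conjugate h^-1 * (a * h). *)
Definition element_conjugate (H : finGroupType) (G : groupType)
    (phi1 phi2 : {multiplicative H -> G}) : Prop :=
  forall x : H, exists h : G, phi1 x = phi2 x ^ h.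

Definition globally_conjugate (H : finGroupType) (G : groupType)
    (phi1 phi2 : {multiplicative H -> G}) : Prop :=
  exists h : G, forall x : H, phi1 x = phi2 x ^ h.

Definition acceptable (G : groupType) : Prop :=
  forall (H : finGroupType) (phi1 phi2 : {multiplicative H -> G}),
    element_conjugate phi1 phi2 -> globally_conjugate phi1 phi2.

End Acceptable.

(* iota makes K an algebraic closure of F; algebraic closedness of K is carried
   by its type. *)
Definition algebraic_closure (F : fieldType) (K : closedFieldType)
    (iota : {rmorphism F -> K}) : Prop :=
  forall x : K, algebraicOver iota x.

(* Main.v *)
From HB Require Import structures.
Require Import Defs.
From mathcomp Require Import all_boot all_order all_fingroup all_algebra.

(** Two commuting families of transvections witness the failure of
    acceptability.  A row vector w of length n - 1 gives the unitriangular
    matrix T(w) with blocks 1, w, 0, 1; both w |-> T(w) and w |-> T(w)^T turn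
    addition into multiplication.  With H the additive group of F^(n-1), embedded
    in K^(n-1) through iota, this yields two homomorphisms H -> SL(n, K).

    Element by element they agree up to conjugation: for w <> 0 both T(w) and
    T(w)^T are transvections, and for n >= 3 all transvections are conjugate in
    SL(n, K).  An explicit conjugator is the symmetric matrix with blocks
    0, w, w^T, S ([transvection_conj_trmx]), where S can be chosen to make the
    determinant 1 ([det_bordered_eq1]).

    Globally they are not conjugate: on column vectors, the common fixed space
    of all the T(w) is a line, whereas that of all the T(w)^T is a hyperplane.
    In matrix terms, a matrix intertwining the two homomorphisms has a zero first
    column ([intertwiner_first_col_eq0]), so it is not invertible. *)

Set Implicit Arguments.
Unset Strict Implicit.
Unset Printing Implicit Defensive.

Import GRing.Theory.
Local Open Scope ring_scope.

(** * Transvections *)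

Section Transvection.
Variables (R : comUnitRingType) (n : nat).
Implicit Types (w : 'rV[R]_n).

Definition transvection w : 'M[R]_(1 + n) := block_mx 1%:M w 0 1%:M.

Lemma det_transvection w : \det (transvection w) = 1.
Proof. by rewrite det_ublock !det1 mulr1. Qed.

Lemma transvectionD w1 w2 :
  transvection (w1 + w2) = transvection w1 *m transvection w2.
Proof.
by rewrite mulmx_block !mul1mx !mulmx1 !mul0mx !mulmx0 !add0r addr0 addrC.
Qed.

Lemma tr_transvection w : (transvection w)^T = block_mx 1%:M 0 w^T 1%:M.
Proof. by rewrite tr_block_mx !trmx1 trmx0. Qed.

(** Both products have the same lower right block w^T w + S and agree with the
    bordered matrix elsewhere; S stays free to adjust the determinant. *)
Lemma transvection_conj_trmx w (S : 'M[R]_n) :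
  block_mx 0 w w^T S *m transvection w
  = (transvection w)^T *m block_mx 0 w w^T S.
Proof.
by rewrite tr_transvection !mulmx_block !(mul1mx, mulmx1, mul0mx, mulmx0)
           !(add0r, addr0).
Qed.

Lemma intertwiner_blocks w A B C D :
  block_mx A B C D *m transvection w = (transvection w)^T *m block_mx A B C D ->
  A *m w = 0 /\ C *m w = w^T *m B.
Proof.
rewrite tr_transvection !mulmx_block !(mul1mx, mulmx1, mul0mx, mulmx0).
rewrite !(add0r, addr0) => /eq_block_mx[_ AwB _ CwD]; split.
  by apply: (addIr B); rewrite AwB add0r.
by apply: (addIr D).
Qed.

(** Comparing C * delta_i = delta_i^T * B entrywise confines the column C to its
    i-th entry; two different i leave nothing. *)
Lemma intertwiner_first_col_eq0 (i j : 'I_n) (h : 'M[R]_(1 + n)) : i != j ->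
    (forall k, k = i \/ k = j ->
       h *m transvection (delta_mx 0 k) = (transvection (delta_mx 0 k))^T *m h) ->
  lsubmx h = 0.
Proof.
rewrite -[h]submxK; move: (ulsubmx h) (ursubmx h) (dlsubmx h) (drsubmx h).
move=> A B C D neq_ij hT; rewrite block_mxEh row_mxKl.
have blk k kij := intertwiner_blocks (hT k kij).
have C0 k l : k = i \/ k = j -> l != k -> C l 0 = 0.
  move=> /blk[_ /matrixP/(_ l k)]; rewrite !mxE !big_ord1 !mxE !eqxx mulr1.
  by move=> -> /negPf->; rewrite mul0r.
have -> : C = 0.
  apply/colP => l; rewrite !mxE.
  have [eq_li | neq_li] := eqVneq l i; last exact: (C0 i l (or_introl _)).
  by apply: (C0 j l (or_intror _)); rewrite // eq_li.
suff -> : A = 0 by rewrite col_mx0.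
have [/matrixP/(_ 0 i) + _] := blk i (or_introl (erefl i)).
rewrite !mxE big_ord1 !mxE !eqxx mulr1 => A0.
by apply/matrixP => k l; rewrite !ord1 A0 mxE.
Qed.

End Transvection.

(** * Conjugators of determinant one *)

Section BorderedDeterminant.
Variable K : fieldType.

Lemma det_antidiag (a : K) :
  \det (block_mx 0 a%:M a%:M 0 : 'M_(1 + 1)) = - a ^+ 2.
Proof.
set J := block_mx _ _ _ _.
have triJ : block_mx 1%:M 1%:M 0 1%:M *m J *m block_mx 1%:M (- 1%:M) 0 1%:M
            = block_mx a%:M 0 a%:M (- a%:M).
  rewrite !mulmx_block !(mul1mx, mulmx1, mul0mx, mulmx0, mulmxN).
  by rewrite !(add0r, addr0) addNr.
have := congr1 determinant triJ.
rewrite !det_mulmx !det_ublock det_lblock -raddfN /= !det_scalar1.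
by rewrite !mulr1 mul1r mulrN.
Qed.

(** Take S = diag(0, S').  The leading 2 x 2 block J is then antidiagonal with
    entries a, hence invertible, and its Schur complement is S' itself since
    J^-1 is antidiagonal too; so det S' = - a^-2 makes the determinant 1. *)
Lemma det_bordered_head (a : K) m (w : 'rV_m.+1) : a != 0 ->
  let u : 'rV_(1 + m.+1) := row_mx a%:M w in
  exists S, \det (block_mx 0 u u^T S : 'M_(1 + (1 + m.+1))) = 1.
Proof.
move=> a0 u; pose S' : 'M[K]_(1 + m) := block_mx (- a ^- 2)%:M 0 0 1%:M.
exists (block_mx 0 0 0 S'); rewrite /u tr_row_mx tr_scalar_mx block_mxA.
rewrite castmx_id; set J := block_mx 0 a%:M _ _.
pose Q : 'M[K]_(1 + 1, m.+1) := col_mx 0 (a^-1 *: w).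
pose L : 'M[K]_((1 + 1) + (1 + m)) := block_mx J 0 (row_mx w^T 0) S'.
pose U : 'M[K]_((1 + 1) + (1 + m)) := block_mx 1%:M Q 0 1%:M.
transitivity (\det (L *m U)).
  rewrite mulmx_block !(mulmx0, mul0mx, mulmx1, addr0, add0r) /Q /J.
  rewrite mul_block_col mul_row_col !(mulmx0, mul0mx, addr0, add0r).
  by rewrite mul_scalar_mx scalerA divff // scale1r.
rewrite det_mulmx det_lblock det_ublock.
rewrite det_antidiag /S' det_ublock det_scalar1 !det1 !mulr1 mulrN mulNr opprK.
by rewrite divff // expf_neq0.
Qed.

(** A permutation of the coordinates brings a nonzero entry of w to the front. *)
Lemma det_bordered_eq1 m (w : 'rV[K]_m.+2) : w != 0 ->
  exists S, \det (block_mx 0 w w^T S : 'M_(1 + m.+2)) = 1.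
Proof.
case/rV0Pn => i wi0; pose s : 'M[K]_m.+2 := tperm_mx 0 i.
have ss : s *m s = 1%:M by rewrite -perm_mxM tperm2 perm_mx1.
have [S detS] := det_bordered_head (rsubmx (w *m s : 'rV_(1 + m.+1))) wi0.
have ws : row_mx (w 0 i)%:M (rsubmx (w *m s : 'rV_(1 + m.+1))) = w *m s.
  rewrite -[RHS](@hsubmxK _ 1 1 m.+1); congr row_mx.
  apply/rowP => j; rewrite ord1 /s -xcolE !mxE eqxx mulr1n.
  have -> : @lshift 1 m.+1 0 = 0 by apply: val_inj.
  by rewrite tpermL.
exists (s *m S *m s).
(* Conjugating by diag(1, s) multiplies the determinant by (det s)^2 = 1. *)
have -> : block_mx 0 w w^T (s *m S *m s) =
    block_mx 1%:M 0 0 s *m block_mx 0 (w *m s) (w *m s)^T S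
                        *m block_mx 1%:M 0 0 s.
  rewrite !mulmx_block !(mulmx0, mul0mx, mulmx1, mul1mx, addr0, add0r).
  rewrite -(mulmxA w) ss mulmx1 trmx_mul mulmxA.
  by rewrite (tr_tperm_mx _ _ _ : s^T = s) ss mul1mx.
rewrite !det_mulmx -ws detS mulr1 -det_mulmx mulmx_block.
by rewrite !(mulmx0, mul0mx, mulmx1, addr0, add0r) ss det_ublock !det1 mulr1.
Qed.

End BorderedDeterminant.

(** * Two homomorphisms from an elementary abelian group *)

Section Homomorphisms.
Variables (F : finFieldType) (K : fieldType) (iota : {rmorphism F -> K}).
Variable n : nat.
Implicit Types x y : 'rV[F]_n.

Fact transvection_SL_subproof x : \det (transvection (map_mx iota x)) == 1.
Proof. by rewrite det_transvection. Qed.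

Fact tr_transvection_SL_subproof x :
  \det (transvection (map_mx iota x))^T == 1.
Proof. by rewrite det_tr det_transvection. Qed.

Definition transvection_SL x : SL (1 + n) K :=
  SpecialLinear (transvection_SL_subproof x).
Definition tr_transvection_SL x : SL (1 + n) K :=
  SpecialLinear (tr_transvection_SL_subproof x).

Fact transvection_SL_mul : {morph transvection_SL : x y / (x * y)%g}.
Proof.
move=> x y; apply: val_inj; rewrite /= FinRing.zmodMgE map_mxD.
exact: transvectionD.
Qed.

Fact tr_transvection_SL_mul : {morph tr_transvection_SL : x y / (x * y)%g}.
Proof.
(* Transposition reverses products; commutativity of addition restores the
   order. *)
move=> x y; apply: val_inj.
by rewrite /= FinRing.zmodMgE addrC map_mxD transvectionD trmx_mul.
Qed.

HB.instance Definition _ :=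
  isMultiplicative.Build 'rV[F]_n (SL (1 + n) K) transvection_SL
    transvection_SL_mul.
HB.instance Definition _ :=
  isMultiplicative.Build 'rV[F]_n (SL (1 + n) K) tr_transvection_SL
    tr_transvection_SL_mul.

End Homomorphisms.

Lemma SL_eq_conjg n (R : comUnitRingType) (A B h : SL n R) :
  A = (B ^ h)%g <-> SLval h *m SLval A = SLval B *m SLval h.
Proof.
split=> [-> | hA]; first by rewrite -[LHS]/(SLval (h * B ^ h)%g) conjgE mulKVg.
have {}hA : (h * A = B * h)%g by apply: val_inj.
by rewrite conjgE -hA mulKg.
Qed.

Section NotAcceptable.
Variables (F : finFieldType) (K : fieldType) (iota : {rmorphism F -> K}).
Variable m : nat.
Let phi1 : {multiplicative 'rV[F]_m.+2 -> SL (1 + m.+2) K} :=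
  @transvection_SL F K iota m.+2.
Let phi2 : {multiplicative 'rV[F]_m.+2 -> SL (1 + m.+2) K} :=
  @tr_transvection_SL F K iota m.+2.

Lemma element_conjugate_transvections : element_conjugate phi1 phi2.
Proof.
move=> x; have [-> | x0] := eqVneq x 0.
  exists 1%g; apply/SL_eq_conjg.
  by rewrite mulmx1 mul1mx /= map_mx0 tr_transvection trmx0.
have [|S /eqP detS] := @det_bordered_eq1 K m (map_mx iota x).
  by rewrite map_mx_eq0.
by exists (SpecialLinear detS); apply/SL_eq_conjg/transvection_conj_trmx.
Qed.

Lemma not_globally_conjugate_transvections : ~ globally_conjugate phi1 phi2.
Proof.
case=> h hP.
have h0 : lsubmx (SLval h : 'M_(1 + m.+2)) = 0.
  apply: (@intertwiner_first_col_eq0 _ _ 0 ord_max) => // k _.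
  by move/SL_eq_conjg: (hP (delta_mx 0 k)); rewrite /= map_delta_mx.
have /eqP := SLdet h; rewrite (expand_det_col _ (lshift m.+2 0)) big1.
  by move/esym/eqP; rewrite oner_eq0.
by move=> k _; move/matrixP/(_ k 0): h0; rewrite !mxE => ->; rewrite mul0r.
Qed.

End NotAcceptable.

Local Close Scope ring_scope.

Theorem proposition4p7 (p q k : nat) (F : finFieldType) (K : closedFieldType)
    (iota : {rmorphism F -> K}) (n : nat) :
  prime p -> 0 < k -> q = p ^ k -> #|F| = q -> algebraic_closure iota ->
  4 <= n -> ~ acceptable (SL n K).
Proof.
move=> _ _ _ _ _; case: n => [|[|[|m]]] // _ acc.
exact/(@not_globally_conjugate_transvections F K iota m)/acc
     /element_conjugate_transvections.
Qed.
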